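(* Let $T\ge 1$ be an integer, $0<c_1\le c_2$ real numbers, $\{R_k\}_{k\in N_T}$ a sequence of real symmetric positive definite $n\times n$ matrices, and $\{A_k\}_{k\in N_{T-1}},\{C_k\}_{k\in N_{T-1}}$ real $n\times n$ matrices. The system $x_{k+1}=A_kx_k+C_kx_kw_k$, $x_0\in\mathbb{R}^n$, $k\in N_{T-1}$, is finite-time stable with respect to $(c_1,c_2,T,\{R_k\}_{k\in N_T})$ if and only if $$\phi_{k,0}'(I_{2^k}\otimes R_k)\phi_{k,0}<\frac{c_2}{c_1}R_0\qquad\text{for all } k\in N_T.$$
   Context: $N_T:=\{0,1,\dots,T\}$. $M'$ is the transpose, $\otimes$ the Kronecker product, $I_m$ the $m\times m$ identity; $M<N$ for symmetric matrices means $N-M$ is positive definite. $\|x\|_R^2:=x'Rx$. $\{w_k\}_{k\in N_{T-1}}$ is a sequence of independent real random variables on a complete probability space with $E[w_k]=0$ and $E[w_kw_j]=\delta_{kj}$ (Kronecker delta); $x_0$ is deterministic. Finite-time stability: the system is finite-time stable with respect to $(c_1,c_2,T,\{R_k\}_{k\in N_T})$ if for every deterministic $x_0\in\mathbb{R}^n$, $\|x_0\|_{R_0}^2\le c_1$ implies $E\|x_k\|_{R_k}^2<c_2$ for all $k\in N_T$. State transition matrices: $\phi_{k,k}=I_n$ and, for $l>k$, $$\phi_{l,k}=\begin{bmatrix}(I_{2^{l-k-1}}\otimes A_{l-1})\phi_{l-1,k}\\ (I_{2^{l-k-1}}\otimes C_{l-1})\phi_{l-1,k}\end{bmatrix},$$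 a $2^{l-k}n\times n$ matrix. *)

(* Defs.v *)
From HB Require Import structures.
From mathcomp Require Import all_boot all_order all_algebra.
From mathcomp Require Import finmap.
From mathcomp Require Import all_classical all_reals all_analysis.
From mathcomp.real_closed Require Import mxtens.

Set Implicit Arguments.
Unset Strict Implicit.
Unset Printing Implicit Defensive.

Import Order.TTheory GRing.Theory Num.Theory.

Local Open Scope classical_set_scope.
Local Open Scope ring_scope.

Notation "A *t B" := (tensmx A B)
  (at level 40, left associativity, format "A  *t  B") : ring_scope.

Section Matrices.
Context {R : realType} {n : nat}.

(* x' M x, the entry of a 1 x 1 matrix *)
Definition sqnorm (M : 'M[R]_n) (x : 'cV[R]_n) : R := (x^T *m M *m x) 0 0.

Definition posdefmx (M : 'M[R]_n) : Prop :=
  M \is symmetricmx /\ forall x : 'cV[R]_n, x != 0 -> 0 < sqnorm M x.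

Definition posdef_lt (M N : 'M[R]_n) : Prop := posdefmx (N - M).

Lemma transmx_dim0 : n = (2 ^ 0 * n)%N.
Proof. by rewrite expn0 mul1n. Qed.

Lemma transmx_dimS d : (2 ^ d * n + 2 ^ d * n = 2 ^ d.+1 * n)%N.
Proof. by rewrite addnn -mul2n mulnA -expnS. Qed.

(* transmx A C k d is the state transition matrix phi_{l,k} for l = k + d; it
   is indexed by the gap d = l - k so that its type only exists for l >= k. *)
Fixpoint transmx (A C : nat -> 'M[R]_n) (k d : nat) : 'M[R]_(2 ^ d * n, n) :=
  if d is d'.+1 then
    castmx (transmx_dimS d', erefl n)
      (col_mx (((1%:M : 'M[R]_(2 ^ d')) *t A (k + d')%N) *m transmx A C k d')
              (((1%:M : 'M[R]_(2 ^ d')) *t C (k + d')%N) *m transmx A C k d'))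
  else castmx (transmx_dim0, erefl n) 1%:M.

End Matrices.

Section Stochastic.
Context {d : measure_display} {Omega : measurableType d} {R : realType}.

Definition mutually_independent (P : probability Omega R) (I : choiceType)
    (D : set I) (X : I -> {RV P >-> R}) : Prop :=
  forall (J : {fset I}) (B : I -> set R),
    [set` J] `<=` D -> (forall i, i \in J -> measurable (B i)) ->
    P (\bigcap_(i in [set` J]) (X i @^-1` B i)) =
      (\prod_(i <- J) P (X i @^-1` B i))%E.

(* state A C w x0 k is x_k, where x_{k+1} = A_k x_k + C_k x_k w_k *)
Fixpoint state n (A C : nat -> 'M[R]_n) (w : nat -> Omega -> R)
    (x0 : 'cV[R]_n) (k : nat) (omega : Omega) : 'cV[R]_n :=
  if k is k'.+1 then
    A k' *m state A C w x0 k' omega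
      + w k' omega *: (C k' *m state A C w x0 k' omega)
  else x0.

(* x x0 k is the state at time k when started from the deterministic x0 *)
Definition finite_time_stable (P : probability Omega R) n
    (x : 'cV[R]_n -> nat -> Omega -> 'cV[R]_n)
    (c1 c2 : R) (T : nat) (W : nat -> 'M[R]_n) : Prop :=
  forall x0 : 'cV[R]_n, sqnorm (W 0%N) x0 <= c1 ->
    forall k : nat, (k <= T)%N ->
      ('E_P[fun omega => sqnorm (W k) (x x0 k omega)] < c2%:E)%E.

End Stochastic.

(* Main.v *)
Require Import Defs.
From HB Require Import structures.
From mathcomp Require Import all_boot all_order all_algebra.
From mathcomp Require Import finmap.
From mathcomp Require Import all_classical all_reals all_analysis.
From mathcomp.real_closed Require Import mxtens.
From mathcomp Require Import measurable_realfun lra ring.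

(** Write G_k(V) = phi_{k,0}' (I (x) V) phi_{k,0}.  The whole theorem is the
    identity E (x_k' V x_k) = x_0' G_k(V) x_0 for k <= T
    ([expectation_state_sqnorm]).  Granted this, stability says that
    x' R_0 x <= c1 implies x' G_k(R_k) x < c2, for all x and k, and since both
    sides are quadratic in x, rescaling x onto the ellipsoid x' R_0 x = c1 turns
    this into x' G_k(R_k) x < (c2 / c1) x' R_0 x for x <> 0.

    Stacking the two blocks of phi_{k+1,0} gives the recursion
    G_{k+1}(V) = G_k(A_k' V A_k) + G_k(C_k' V C_k) ([transgramS]).  On the
    probabilistic side, x_{k+1}' V x_{k+1} is a polynomial of degree 2 in w_k
    whose coefficients are quadratic forms in x_k, and those of degree 0 and 2
    are exactly the forms A_k' V A_k and C_k' V C_k ([sqnorm_step]).  The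
    coefficient of degree 1 should be killed by E w_k = 0, which takes
    independence of w_k and x_k.  Rather than setting up independence of w_k from
    the vector (w_0, ..., w_{k-1}), the induction on k in [state_moment] carries
    along an arbitrary monomial, of degree at most 2 in each variable, in the
    noises w_k, ..., w_{T-1} that x_k has not yet met; each step absorbs one noise
    into the monomial.  At k = 0 the state is deterministic, so only the moments
    of monomials in w_0, ..., w_{T-1} remain ([noise_moment]).

    These moments factor because the expectation of a product of functions of
    independent variables is the product of the expectations
    ([independent_integral_prod]).  Independence gives this for indicators; the
    functions are then replaced one coordinate at a time ([coordinatewise_ind]),
    first by nonnegative integrable ones (monotone convergence), next by
    integrable ones (difference of positive and negative parts). *)

Set Implicit Arguments.
Unset Strict Implicit.
Unset Printing Implicit Defensive.

Import Order.TTheory GRing.Theory Num.Theory.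

Local Open Scope classical_set_scope.
Local Open Scope ring_scope.

(** * Gram matrices of the state transition matrices *)

Section Gram.
Context {R : realType} {n : nat}.
Implicit Types (V : 'M[R]_n) (A C : nat -> 'M[R]_n) (x : 'cV[R]_n).

Definition transgram A C k V : 'M[R]_n :=
  (transmx A C 0 k)^T *m ((1%:M : 'M[R]_(2 ^ k)) *t V) *m transmx A C 0 k.

Lemma symmetricmxP V : V \is symmetricmx <-> V^T = V.
Proof.
by split => [|VV]; [move/is_hermitianmxP => {2}->|apply/is_hermitianmxP];
  rewrite expr0 scale1r map_mx_id// VV.
Qed.

(** Moves the dimension cast of [transmx] from the outer factors to the middle
    one, where it only regroups indices. *)
Lemma castmx_congr p q (e : p = q) (B : 'M[R]_(p, n)) (N : 'M[R]_q) :
  (castmx (e, erefl n) B)^T *m N *m castmx (e, erefl n) B =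
  B^T *m castmx (esym e, esym e) N *m B.
Proof. by case: q / e N => N; rewrite !castmx_id. Qed.

(** Row i of I (x) V lies in the V-block numbered i / n, so the first half of
    the rows meets only the first half of the 2 ^ (d + 1) blocks. *)
Lemma tens1mx_block d V :
  castmx (esym (transmx_dimS d), esym (transmx_dimS d))
    ((1%:M : 'M[R]_(2 ^ d.+1)) *t V) =
  block_mx ((1%:M : 'M[R]_(2 ^ d)) *t V) 0 0 ((1%:M : 'M[R]_(2 ^ d)) *t V).
Proof.
apply/matrixP => i j; rewrite castmxE /=.
have n0 : (0 < n)%N.
  by case: (posnP n) i => // -> [i]; rewrite muln0.
rewrite -[i]splitK -[j]splitK.
have dv a : ((2 ^ d * n + a) %/ n = 2 ^ d + a %/ n)%N by rewrite divnMDl.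
have dl (a : 'I_(2 ^ d * n)) : (a %/ n < 2 ^ d)%N by rewrite ltn_divLR.
case: (fintype.split i) => a; case: (fintype.split j) => b /=;
  rewrite ?(block_mxEul, block_mxEur, block_mxEdl, block_mxEdr) !mxE;
  rewrite -?val_eqE /= ?dv ?modnMDl ?eqn_add2l.
- by congr (_ * V _ _); apply: val_inj.
- by rewrite (_ : (_ == _) = false) ?mul0r// ltn_eqF// ltn_addr.
- by rewrite (_ : (_ == _) = false) ?mul0r// gtn_eqF// ltn_addr.
- by congr (_ * V _ _); apply: val_inj; rewrite /= modnMDl.
Qed.

Lemma transgram0 A C V : transgram A C 0 V = V.
Proof.
rewrite /transgram /= castmx_congr trmx1 mul1mx mulmx1.
apply/matrixP => i j; rewrite castmxE !mxE /= -val_eqE /=.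
have lt (a : 'I_n) : (a %/ n = 0)%N by rewrite divn_small.
rewrite !lt mul1r; congr (V _ _); apply: val_inj; rewrite /= modn_small//.
Qed.

(** The block diagonal I (x) V acts separately on the two halves of
    phi_{k+1,0}, and (I (x) A)' (I (x) V) (I (x) A) = I (x) A' V A. *)
Lemma transgramS A C k V : transgram A C k.+1 V =
  transgram A C k ((A k)^T *m V *m A k) + transgram A C k ((C k)^T *m V *m C k).
Proof.
rewrite /transgram /= castmx_congr tens1mx_block tr_col_mx mul_row_block.
rewrite mul_row_col !mulmx0 addr0 add0r !trmx_mul !trmx_tens !trmx1 !mulmxA.
rewrite add0n -!(mulmxA _ (_ *t _) (_ *t _)) !tensmx_mul !mulmx1.
by rewrite -!(mulmxA _ (_ *t _) (_ *t _)) !tensmx_mul !mulmx1 !mulmxA.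
Qed.

Lemma transgram_sym A C k V : V \is symmetricmx ->
  transgram A C k V \is symmetricmx.
Proof.
rewrite !symmetricmxP /transgram => Vs.
by rewrite !trmx_mul trmxK trmx_tens trmx1 Vs mulmxA.
Qed.

Lemma sqnormD V V' x : sqnorm (V + V') x = sqnorm V x + sqnorm V' x.
Proof. by rewrite /sqnorm mulmxDr mulmxDl mxE. Qed.

Lemma sqnormZ a V x : sqnorm (a *: V) x = a * sqnorm V x.
Proof. by rewrite /sqnorm -scalemxAr -scalemxAl mxE. Qed.

Lemma sqnorm_scale V a x : sqnorm V (a *: x) = a ^+ 2 * sqnorm V x.
Proof.
have tZ : (a *: x)^T = a *: x^T by apply/matrixP => i j; rewrite !mxE.
by rewrite /sqnorm tZ -!scalemxAl -scalemxAr !mxE mulrA.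
Qed.

Lemma sqnorm_step V (A C : 'M[R]_n) (a : R) x :
  sqnorm V (A *m x + a *: (C *m x)) =
  sqnorm (A^T *m V *m A) x + a * sqnorm (A^T *m V *m C + C^T *m V *m A) x
    + a ^+ 2 * sqnorm (C^T *m V *m C) x.
Proof.
have tDZ : (A *m x + a *: (C *m x))^T = x^T *m A^T + a *: (x^T *m C^T).
  by rewrite -!trmx_mul; apply/matrixP => i j; rewrite !mxE.
rewrite sqnormD /sqnorm tDZ !(mulmxDl, mulmxDr) -!scalemxAl -!scalemxAr.
rewrite !mulmxA !mxE; ring.
Qed.

End Gram.

(** * Replacing functions one coordinate at a time *)

(** To pass from families with all members in the small class S to families in
    the large class L, it suffices to enlarge a single coordinate j while the
    other members are arbitrary elements of L: by induction on k, the property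
    holds when the coordinates from k on are in S. *)
Lemma coordinatewise_ind (F : Type) (T : nat) (S L : nat -> F -> Prop)
    (Q : (nat -> F) -> Prop) :
    (forall i f, S i f -> L i f) ->
    (forall f j, (j < T)%N -> (forall i, (i < T)%N -> L i (f i)) ->
      (forall g, S j g -> Q [eta f with j |-> g]) ->
      forall g, L j g -> Q [eta f with j |-> g]) ->
    (forall f, (forall i, (i < T)%N -> S i (f i)) -> Q f) ->
  forall f, (forall i, (i < T)%N -> L i (f i)) -> Q f.
Proof.
move=> SL ext QS f Lf.
suff: forall k, (k <= T)%N -> forall f, (forall i, (i < T)%N -> L i (f i)) ->
    (forall i, (k <= i < T)%N -> S i (f i)) -> Q f.
  apply; [exact: leqnn|exact: Lf|move=> i /andP[/leq_ltn_trans/[apply]]].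
  by rewrite ltnn.
elim=> [_ {Lf}f _ Sf|k IHk kT {Lf}f Lf Sf]; first exact: QS.
have -> : f = [eta f with k |-> f k].
  by apply/funext => i /=; case: eqP => // ->.
apply: ext => // [g Sg|]; last exact: Lf.
apply: IHk => [|i iT /=|i /andP[ki iT] /=]; first exact: ltnW.
- by case: eqP => [->|_]; [exact: SL|exact: Lf].
- by case: eqVneq => [->//|ik]; apply: Sf; rewrite iT ltn_neqAle eq_sym ik ki.
Qed.

Lemma big_ord_set_at (A S : Type) (idx : S) (op : Monoid.com_law idx)
    (T j : nat) (F : A -> nat -> S) (f : nat -> A) (g : A) : (j < T)%N ->
  \big[op/idx]_(i < T) F ([eta f with j |-> g] i) i =
  op (\big[op/idx]_(i < T | i != j :> nat) F (f i) i) (F g j).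
Proof.
move=> jT; rewrite (bigD1 (Ordinal jT))//= eqxx Monoid.mulmC; congr (op _ _).
by apply: eq_big => [i|i /negbTE]; rewrite -val_eqE //= => ->.
Qed.

(** * Expectation of a product of independent variables *)

Section Independence.
Context {d : measure_display} {Omega : measurableType d} {R : realType}.
Import HBNNSimple.

(** The hypothesis says that the law of Y weighted by G is a times the law of Y,
    so the same holds of integrals against these laws: by linearity for simple
    functions, then by monotone convergence. *)
Lemma ge0_integral_mul_comp (mu : {measure set Omega -> \bar R})
    (G : Omega -> R) (Y : {mfun Omega >-> R}) (a : R) :
    measurable_fun setT G -> (forall x, 0 <= G x) -> 0 <= a ->
    (forall B : set R, measurable B ->
      (\int[mu]_x (G x * \1_B (Y x))%:E = a%:E * mu (Y @^-1` B))%E) ->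
  forall f : R -> R, measurable_fun setT f -> (forall y, 0 <= f y) ->
  (\int[mu]_x (G x * f (Y x))%:E = a%:E * \int[mu]_x (f (Y x))%:E)%E.
Proof.
move=> mG G0 a0 GB f mf f0.
have mY : measurable_fun setT Y by [].
have mEf : measurable_fun [set: R] (fun y => (f y)%:E).
  exact/measurable_EFinP.
have Ef0 y : setT y -> (0 <= (f y)%:E)%E by move=> _; rewrite lee_fin.
pose h := nnsfun_approx measurableT mEf.
have mGh n : measurable_fun setT (fun x => (G x * h n (Y x))%:E).
  apply/measurable_EFinP; apply: measurable_funM => //.
  exact: measurableT_comp.
have mh n : measurable_fun setT (fun x => (h n (Y x))%:E).
  by apply/measurable_EFinP; exact: measurableT_comp.
have h_nd x : {homo h^~ x : n m / (n <= m)%N >-> n <= m}.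
  by move=> n m nm; exact: (lefP _ _ (nd_nnsfun_approx measurableT mEf nm)).
have hE n x : h n x = \sum_(r <- fset_set (range (h n)))
    r * \1_(h n @^-1` [set r]) x.
  by rewrite [LHS]fimfunE fsbig_finite.
(* nonnegative even if r < 0, as h n does not take the value r then *)
have pos n r y : 0 <= r * \1_(h n @^-1` [set r]) y.
  rewrite indicE; case: (boolP (y \in _)) => [|_]; last by rewrite mulr0.
  by rewrite inE/= => <-; rewrite mulr1.
have mr n r : measurable (h n @^-1` [set r]) by exact: measurable_funPTI.
have mi n r : measurable_fun setT (fun x => \1_(h n @^-1` [set r]) (Y x) : R).
  by apply: (@measurableT_comp _ _ _ _ _ _ (\1_(h n @^-1` [set r]) : R -> R)).
have indY (B : set R) : measurable B ->
    (\int[mu]_x (\1_B (Y x))%:E = mu (Y @^-1` B))%E.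
  move=> mB; rewrite -[in RHS](setIT (Y @^-1` B)) -integral_indic//.
  exact: measurable_funPTI.
have hint n : (\int[mu]_x (G x * h n (Y x))%:E =
    a%:E * \int[mu]_x (h n (Y x))%:E)%E.
  under eq_integral do rewrite hE mulr_sumr -sumEFin.
  under [in RHS]eq_integral do rewrite hE -sumEFin.
  rewrite !ge0_integral_sum//.
  - rewrite ge0_sume_distrr; last first.
      by move=> r _; apply: integral_ge0 => x _; rewrite lee_fin pos.
    apply: eq_big_seq => r; rewrite in_fset_set// inE => -[y _ ry].
    have r0 : 0 <= r by rewrite -ry.
    under eq_integral do rewrite mulrCA EFinM.
    under [in RHS]eq_integral do rewrite EFinM.
    rewrite !ge0_integralZl_EFin//.
    + by rewrite GB// muleCA indY.
    + by apply/measurable_EFinP; exact: mi.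
    + by move=> x _; rewrite lee_fin mulr_ge0.
    + by apply/measurable_EFinP; exact: measurable_funM.
  - move=> r; apply/measurable_EFinP.
    by apply: measurable_funM => //; exact: mi.
  - by move=> r x _; rewrite lee_fin pos.
  - move=> r; apply/measurable_EFinP; apply: measurable_funM => //.
    by apply: measurable_funM => //; exact: mi.
  - by move=> r x _; rewrite lee_fin mulr_ge0.
have hcvg y : (h n y)%:E @[n --> \oo] --> (f y)%:E.
  exact: (cvg_nnsfun_approx measurableT mEf Ef0).
have cvgG : (\int[mu]_x (G x * h n (Y x))%:E @[n --> \oo] -->
    \int[mu]_x (G x * f (Y x))%:E)%E.
  have -> : (\int[mu]_x (G x * f (Y x))%:E =
      \int[mu]_x limn (fun n => (G x * h n (Y x))%:E))%E.
    apply: eq_integral => x _; apply/esym/cvg_lim => //.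
    under eq_fun do rewrite EFinM.
    by rewrite EFinM; apply: cvgeZl => //; exact: hcvg.
  apply: cvg_monotone_convergence => //.
  - by move=> n x _; rewrite lee_fin mulr_ge0.
  - by move=> x _ n m nm; rewrite lee_fin ler_wpM2l// h_nd.
have cvgf : (\int[mu]_x (h n (Y x))%:E @[n --> \oo] -->
    \int[mu]_x (f (Y x))%:E)%E.
  have -> : (\int[mu]_x (f (Y x))%:E =
      \int[mu]_x limn (fun n => (h n (Y x))%:E))%E.
    by apply: eq_integral => x _; apply/esym/cvg_lim => //; exact: hcvg.
  apply: cvg_monotone_convergence => //.
  - by move=> n x _; rewrite lee_fin.
  - by move=> x _ n m nm; rewrite lee_fin h_nd.
have aE : a%:E \is a fin_num by [].
have := cvgeZl aE cvgf; under eq_fun do rewrite -hint.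
exact: cvg_unique cvgG.
Qed.

Variables (P : probability Omega R) (T : nat) (X : nat -> {RV P >-> R}).
Hypothesis indX : mutually_independent `I_T X.

Lemma independent_integral_prod_indic (B : nat -> set R) :
    (forall i, (i < T)%N -> measurable (B i)) ->
  (\int[P]_x (\prod_(i < T) \1_(B i) (X i x))%:E =
   \prod_(i < T) \int[P]_x (\1_(B i) (X i x))%:E)%E.
Proof.
move=> mB; pose J := [fset i | i in iota 0 T]%fset.
have JE i : (i \in J) = (i < T)%N by rewrite !inE/= mem_iota.
have big_J (S : Type) (idx : S) (op : Monoid.com_law idx) (F : nat -> S) :
    \big[op/idx]_(i <- J) F i = \big[op/idx]_(i < T) F i.
  rewrite -(big_mkord xpredT) /index_iota subn0; apply: perm_big.
  apply: uniq_perm; [exact: fset_uniq|exact: iota_uniq|].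
  by move=> i; rewrite JE mem_iota.
have mXB i : (i < T)%N -> measurable (X i @^-1` B i).
  by move=> iT; apply: measurable_funPTI; exact: mB.
have -> : (\int[P]_x (\prod_(i < T) \1_(B i) (X i x))%:E =
    P (\bigcap_(i in [set` J]) (X i @^-1` B i)))%E.
  have -> : [set` J] = `I_T by apply/seteqP; split=> i /=; rewrite JE.
  rewrite bigcap_mkord -[in RHS](setIT (\big[_/_]_(i < T) _)) -integral_indic//.
    by apply: eq_integral => x _; rewrite (big_morph (fun A => \1_A x : R)
      (id1 := 1) (op1 := *%R))// => [C D|]; rewrite ?indicI// indicT.
  by apply: bigsetI_measurable => i _; exact: mXB.
rewrite indX//; last first.
- by move=> i; rewrite JE; exact: mB.
- by move=> i /=; rewrite JE.
rewrite big_J; apply: eq_bigr => i _.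
by rewrite -[in LHS](setIT (X i @^-1` B i)) -integral_indic//; exact: mXB.
Qed.

(** The classes of functions of the i-th variable through which
    [coordinatewise_ind] passes. *)
Definition indic_coord (_ : nat) (f : R -> R) :=
  exists2 B : set R, measurable B & f = \1_B.

Definition integrable_coord (i : nat) (f : R -> R) :=
  measurable_fun setT f /\ P.-integrable setT (fun x => (f (X i x))%:E).

Definition ge0_integrable_coord (i : nat) (f : R -> R) :=
  integrable_coord i f /\ forall y, 0 <= f y.

Lemma measurable_prod_comp (f : nat -> R -> R) (p : pred nat) :
    (forall i, (i < T)%N -> measurable_fun setT (f i)) ->
  measurable_fun setT (fun x => \prod_(i < T | p i) f i (X i x)).
Proof.
move=> mf; under eq_fun do rewrite big_mkcond.
apply: measurable_prod => i _; case: (p i) => //.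
by apply: measurableT_comp => //; exact: mf.
Qed.

(** All members are integrable, so when the j-th one is replaced the product a
    of the other expectations is finite and [ge0_integral_mul_comp] applies with
    the product of the other functions as weight. *)
Lemma independent_ge0_integral_prod (f : nat -> R -> R) :
    (forall i, (i < T)%N -> ge0_integrable_coord i (f i)) ->
  (\int[P]_x (\prod_(i < T) f i (X i x))%:E =
   \prod_(i < T) \int[P]_x (f i (X i x))%:E)%E.
Proof.
move: f; apply: (@coordinatewise_ind _ _ indic_coord).
- move=> i _ [B mB ->].
  split; last by move=> y; rewrite indicE.
  split; first exact: measurable_indic.
  apply: (@integrable_indic _ _ _ P (X i @^-1` B)); exact: measurable_funPTI.
- move=> f j jT Lf IH g Lg.
  pose G x := \prod_(i < T | i != j :> nat) f i (X i x).
  pose a := (\prod_(i < T | i != j :> nat) \int[P]_x (f i (X i x))%:E)%E.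
  have GE h x : \prod_(i < T) [eta f with j |-> h] i (X i x) = G x * h (X j x).
    exact: (big_ord_set_at _ (fun h i => h (X i x))).
  have aE h : (\prod_(i < T) \int[P]_x ([eta f with j |-> h] i (X i x))%:E =
      a * \int[P]_x (h (X j x))%:E)%E.
    exact: (big_ord_set_at _ (fun h i => \int[P]_x (h (X i x))%:E)%E).
  have a_fin : a \is a fin_num.
    apply: prode_fin_num => i _; apply: integrable_fin_num => //.
    by have [[]] := Lf i (ltn_ord i).
  have a0 : (0 <= a)%E.
    apply: prode_ge0 => i _; apply: integral_ge0 => x _; rewrite lee_fin.
    by have [_] := Lf i (ltn_ord i).
  under eq_integral do rewrite GE; rewrite aE -(fineK a_fin).
  have [[mg _] g0] := Lg.
  apply: ge0_integral_mul_comp => //.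
  + by apply: (@measurable_prod_comp _ (fun i => i != j)) => i /Lf[[]].
  + by move=> x; apply: prodr_ge0 => i _; have [_] := Lf i (ltn_ord i).
  + exact: fine_ge0.
  + move=> B mB; have := IH _ (ex_intro2 _ _ B mB erefl).
    rewrite aE => IHB.
    rewrite fineK// -[in RHS](setIT (X j @^-1` B)) -integral_indic//.
      by rewrite -IHB; apply: eq_integral => x _; rewrite GE.
    exact: measurable_funPTI.
- move=> f Sf.
  have {}Sf (i : nat) : exists B : set R,
      (i < T)%N -> measurable B /\ f i = \1_B.
    case: (ltnP i T) => [iT|_]; last by exists set0.
    by have [B mB fB] := Sf i iT; exists B.
  have [B fB] := choice Sf.
  have fE (i : 'I_T) : f i = \1_(B i) by have [] := fB i (ltn_ord i).
  under eq_integral do under eq_bigr do rewrite fE.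
  under [RHS]eq_bigr do under eq_integral do rewrite fE.
  by apply: independent_integral_prod_indic => i /fB[].
Qed.

(** Both claims are linear in each f i, so they pass from the positive and
    negative parts to their difference.  For nonnegative members, integrability
    of the product is finiteness of the product of the integrals. *)
Theorem independent_integral_prod (f : nat -> R -> R) :
    (forall i, (i < T)%N -> integrable_coord i (f i)) ->
  P.-integrable setT (fun x => (\prod_(i < T) f i (X i x))%:E) /\
  (\int[P]_x (\prod_(i < T) f i (X i x))%:E =
   \prod_(i < T) \int[P]_x (f i (X i x))%:E)%E.
Proof.
move: f; apply: (@coordinatewise_ind _ _ ge0_integrable_coord).
- by move=> i f [].
- move=> f j jT Lf IH g Lg.
  pose G x := \prod_(i < T | i != j :> nat) f i (X i x).
  pose a := (\prod_(i < T | i != j :> nat) \int[P]_x (f i (X i x))%:E)%E.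
  have GE h x : \prod_(i < T) [eta f with j |-> h] i (X i x) = G x * h (X j x).
    exact: (big_ord_set_at _ (fun h i => h (X i x))).
  have aE h : (\prod_(i < T) \int[P]_x ([eta f with j |-> h] i (X i x))%:E =
      a * \int[P]_x (h (X j x))%:E)%E.
    exact: (big_ord_set_at _ (fun h i => \int[P]_x (h (X i x))%:E)%E).
  have a_fin : a \is a fin_num.
    apply: prode_fin_num => i _; apply: integrable_fin_num => //.
    by have [] := Lf i (ltn_ord i).
  have [mg ig] := Lg.
  have Lp : ge0_integrable_coord j g^\+.
    split; last exact: funrpos_ge0.
    split; first exact: measurable_funrpos.
    exact: (integrable_funrpos measurableT ig).
  have Ln : ge0_integrable_coord j g^\-.
    split; last exact: funrneg_ge0.
    split; first exact: measurable_funrneg.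
    exact: (integrable_funrneg measurableT ig).
  have [ip Ep] := IH _ Lp; have [iN En] := IH _ Ln.
  have gE y : g y = g^\+ y - g^\- y by rewrite -[in LHS](funrposBneg g).
  have -> : (fun x => (\prod_(i < T) [eta f with j |-> g] i (X i x))%:E) =
     (fun x => (\prod_(i < T) [eta f with j |-> g^\+] i (X i x))%:E -
               (\prod_(i < T) [eta f with j |-> g^\-] i (X i x))%:E)%E.
    by apply/funext => x; rewrite !GE -EFinB -mulrBr -gE.
  split; first exact: integrableB.
  rewrite integralB_EFin// Ep En !aE -muleBr//.
    congr (_ * _)%E; under [RHS]eq_integral do rewrite gE EFinB.
    by rewrite integralB_EFin//; [have [[]] := Lp|have [[]] := Ln].
  apply: fin_num_adde_defr; apply: integrable_fin_num => //.
  by have [[]] := Lp.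
- move=> f Sf; have E := independent_ge0_integral_prod Sf; split=> //.
  apply/integrableP; split.
    apply/measurable_EFinP.
    by apply: (@measurable_prod_comp _ xpredT) => i /Sf[[]].
  rewrite (eq_integral (fun x => (\prod_(i < T) f i (X i x))%:E)).
    rewrite E ltey_eq prode_fin_num// => i _; rewrite integrable_fin_num//.
    by have [[]] := Sf i (ltn_ord i).
  move=> x _; rewrite gee0_abs// lee_fin prodr_ge0// => i _.
  by have [_] := Sf i (ltn_ord i).
Qed.

End Independence.

(** * Second moments of the state *)

Section Moments.
Context {d : measure_display} {Omega : measurableType d} {R : realType}.
Variables (P : probability Omega R) (T n : nat) (w : nat -> {RV P >-> R}).
Hypothesis w_indep : mutually_independent `I_T w.
Hypothesis w_mean : forall k, (k < T)%N -> ('E_P[w k] = 0)%E.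
Hypothesis w_var : forall k, (k < T)%N ->
  ('E_P[fun omega => (w k omega * w k omega)%R] = 1)%E.

(** Integrability of w_i follows from that of w_i ^ 2 and |w| <= 1 + w ^ 2. *)
Lemma noise_power_integral i e : (i < T)%N -> (e <= 2)%N ->
  P.-integrable setT (fun x => (w i x ^+ e)%:E) /\
  (\int[P]_x (w i x ^+ e)%:E = (e != 1%N)%:R%:E)%E.
Proof.
move=> iT; have mX k : measurable_fun setT (fun x => (w i x ^+ k)%:E).
  by apply/measurable_EFinP; exact: measurable_funX.
have i0 : P.-integrable setT (fun x => (w i x ^+ 0)%:E).
  by under eq_fun do rewrite expr0; exact: finite_measure_integrable_cst.
have E2 : (\int[P]_x (w i x ^+ 2)%:E = 1)%E by rewrite -(w_var iT) unlock.
have i2 : P.-integrable setT (fun x => (w i x ^+ 2)%:E).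
  apply/integrableP; split=> //.
  by under eq_integral do rewrite gee0_abs ?lee_fin ?sqr_ge0//; rewrite E2 ltry.
case: e => [|[|[|//]]] _; split=> //.
- under eq_integral do rewrite expr0.
  by rewrite integral_cst//= probability_setT mule1.
- apply: (le_integrable measurableT (mX 1%N) _ (integrableD measurableT i0 i2)).
  move=> x _; rewrite -EFinD lee_fin expr0 expr1.
  rewrite [leRHS]ger0_norm ?addr_ge0 ?sqr_ge0// ler_norml; nra.
- by transitivity ('E_P[w i])%E; [rewrite unlock|exact: w_mean].
Qed.

Lemma noise_moment (e : nat -> nat) : (forall i, (i < T)%N -> (e i <= 2)%N) ->
  P.-integrable setT (fun x => (\prod_(0 <= i < T) w i x ^+ e i)%:E) /\
  (\int[P]_x (\prod_(0 <= i < T) w i x ^+ e i)%:E =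
   (\prod_(0 <= i < T) (e i != 1%N)%:R)%:E)%E.
Proof.
move=> e2.
have [i|iP EP] := @independent_integral_prod _ _ _ P T w w_indep
    (fun i y => y ^+ e i).
  move=> iT; split; last by have [] := noise_power_integral iT (e2 i iT).
  exact: measurable_funX.
rewrite big_mkord; under eq_integral do rewrite big_mkord.
under eq_fun do rewrite big_mkord; split=> //.
rewrite EP -prodEFin; apply: eq_bigr => i _.
by have [] := noise_power_integral (ltn_ord i) (e2 i (ltn_ord i)).
Qed.

Variables (A C : nat -> 'M[R]_n) (x0 : 'cV[R]_n).

(** The monomial in the future noises makes the induction go through: expanding
    x_{k+1} in terms of x_k and w_k leaves three terms of the same shape at time
    k, with w_k added to the monomial to the power 0, 1 or 2.  The power 1 is
    the one whose factor (e i != 1) vanishes. *)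
Lemma state_moment k : (k <= T)%N -> forall (V : 'M[R]_n) (e : nat -> nat),
    (forall i, (k <= i < T)%N -> (e i <= 2)%N) ->
  P.-integrable setT (fun x => (sqnorm V (state A C (fun i => w i) x0 k x) *
    \prod_(k <= i < T) w i x ^+ e i)%:E) /\
  (\int[P]_x (sqnorm V (state A C (fun i => w i) x0 k x) *
    \prod_(k <= i < T) w i x ^+ e i)%:E =
   (sqnorm (transgram A C k V) x0 * \prod_(k <= i < T) (e i != 1%N)%:R)%:E)%E.
Proof.
elim: k => [_|k IHk kT] V e e2.
  rewrite transgram0 /=; have [iw Ew] := noise_moment e2.
  under eq_fun do rewrite EFinM.
  split; first exact: integrableZl.
  by rewrite integralZl// Ew.
pose ec c := [eta e with k |-> c].
have ec2 c : (c <= 2)%N -> forall i, (k <= i < T)%N -> (ec c i <= 2)%N.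
  move=> c2 i /andP[ki iT] /=; case: eqVneq => // ik; apply: e2.
  by rewrite iT ltn_neqAle eq_sym ik ki.
have ecE (F : nat -> nat -> R) c : \prod_(k <= i < T) F i (ec c i) =
    F k c * \prod_(k.+1 <= i < T) F i (e i).
  rewrite big_ltn//= eqxx; congr (_ * _); apply: eq_big_nat => i /andP[ki _].
  by rewrite gtn_eqF.
have IH c U (c2 : (c <= 2)%N) := IHk (ltnW kT) U (ec c) (ec2 c c2).
have [i0 E0] := IH 0%N ((A k)^T *m V *m A k) isT.
have [i1 E1] := IH 1%N ((A k)^T *m V *m C k + (C k)^T *m V *m A k) isT.
have [i2 E2] := IH 2%N ((C k)^T *m V *m C k) isT.
pose Z c U x := sqnorm U (state A C (fun i => w i) x0 k x) *
  \prod_(k <= i < T) w i x ^+ ec c i.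
have step x : sqnorm V (state A C (fun i => w i) x0 k.+1 x) *
      \prod_(k.+1 <= i < T) w i x ^+ e i =
    Z 0%N ((A k)^T *m V *m A k) x
    + Z 1%N ((A k)^T *m V *m C k + (C k)^T *m V *m A k) x
    + Z 2%N ((C k)^T *m V *m C k) x.
  rewrite /Z !(ecE (fun i c => w i x ^+ c)) /= sqnorm_step; ring.
have i01 := integrableD measurableT i0 i1.
under eq_fun do rewrite step !EFinD.
split; first exact: (integrableD measurableT i01 i2).
rewrite (integralD measurableT i01 i2) (integralD measurableT i0 i1) E0 E1 E2.
rewrite !(ecE (fun _ c => (c != 1%N)%:R)) /= -!EFinD transgramS sqnormD.
by congr _%:E; rewrite mul0r mulr0 addr0 !mul1r mulrDl.
Qed.

Lemma expectation_state_sqnorm k (V : 'M[R]_n) : (k <= T)%N ->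
  ('E_P[fun x => sqnorm V (state A C (fun i => w i) x0 k x)] =
   (sqnorm (transgram A C k V) x0)%:E)%E.
Proof.
move=> kT; have [_] := @state_moment k kT V (fun=> 0%N) (fun _ _ => isT).
rewrite [in X in _ = X -> _]big1// mulr1 expectation.unlock => <-.
by apply: eq_integral => x _; rewrite big1 ?mulr1// => i _; rewrite expr0.
Qed.

End Moments.

Theorem theorem1 (R : realType) (d : measure_display) (Omega : measurableType d)
    (P : probability Omega R) (n T : nat) (c1 c2 : R)
    (W A C : nat -> 'M[R]_n) (w : nat -> {RV P >-> R}) :
  measure_is_complete P ->
  mutually_independent `I_T w ->
  (forall k, (k < T)%N -> ('E_P[w k] = 0)%E) ->
  (forall k j, (k < T)%N -> (j < T)%N ->
     ('E_P[fun omega => (w k omega * w j omega)%R] = (k == j)%:R%:E)%E) ->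
  (1 <= T)%N ->
  0 < c1 -> c1 <= c2 ->
  (forall k, (k <= T)%N -> posdefmx (W k)) ->
  finite_time_stable P (state A C (fun k => w k)) c1 c2 T W <->
  (forall k, (k <= T)%N ->
     posdef_lt ((transmx A C 0 k)^T *m ((1%:M : 'M[R]_(2 ^ k)) *t W k)
             *m transmx A C 0 k)
          ((c2 / c1) *: W 0%N)).
Proof.
move=> _ w_indep w_mean w_cov _ c1_gt0 c12 W_pos.
have c2_gt0 : 0 < c2 := lt_le_trans c1_gt0 c12.
have w_var k : (k < T)%N ->
    ('E_P[fun omega => (w k omega * w k omega)%R] = 1)%E.
  by move=> kT; rewrite w_cov// eqxx.
have meansq x0 k : (k <= T)%N ->
    ('E_P[fun x => sqnorm (W k) (state A C (fun i => w i) x0 k x)] =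
     (sqnorm (transgram A C k (W k)) x0)%:E)%E.
  exact: (expectation_state_sqnorm w_indep w_mean w_var).
have sqnormB k x : sqnorm (c2 / c1 *: W 0%N - transgram A C k (W k)) x =
    c2 / c1 * sqnorm (W 0%N) x - sqnorm (transgram A C k (W k)) x.
  by rewrite -scaleN1r sqnormD !sqnormZ mulN1r.
split=> [stable k kT|gram_lt x0 x0_le k kT].
- split.
    apply/symmetricmxP; rewrite linearB/= linearZ/=.
    have [/symmetricmxP -> _] := W_pos 0%N isT.
    have [/(transgram_sym A C k)/symmetricmxP] := W_pos k kT.
    by rewrite /transgram => ->.
  move=> x x_neq0; rewrite sqnormB subr_gt0.
  have r_gt0 : 0 < sqnorm (W 0%N) x by have [_] := W_pos 0%N isT; apply.
  (* t *: x lies on the boundary of the ellipsoid of initial states *)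
  pose t := Num.sqrt (c1 / sqnorm (W 0%N) x).
  have t2 : t ^+ 2 = c1 / sqnorm (W 0%N) x.
    by rewrite sqr_sqrtr// divr_ge0 // ltW.
  have := stable (t *: x) _ k kT.
  rewrite meansq// lte_fin !sqnorm_scale t2 divfK ?gt_eqF// => /(_ (lexx _)).
  rewrite -ltr_pdivlMl ?divr_gt0// invf_div => lt_c2.
  by rewrite mulrAC (mulrC c2) mulrAC.
- rewrite meansq// lte_fin.
  have [->|x0_neq0] := eqVneq x0 0.
    by rewrite /sqnorm mulmx0 mxE.
  have [_ /(_ x0 x0_neq0)] := gram_lt k kT.
  rewrite sqnormB subr_gt0 => /lt_le_trans; apply.
  by rewrite -mulrA ler_piMr ?(ltW c2_gt0)// ler_pdivrMl// mulr1.
Qed.
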